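(* Let $f(x)=x^TAx+2a^Tx+a_0$ and $g(x)=x^TBx+2b^Tx+b_0$ be quadratic functions on $\mathbb{R}^n$, where $A,B$ are real symmetric $n\times n$ matrices, $a,b\in\mathbb{R}^n$, $a_0,b_0\in\mathbb{R}$. Suppose that $g$ takes both positive and negative values. Then $$\{f\le 0\}\cap\{g=0\}=\emptyset$$ holds if and only if exactly one of the following three mutually exclusive statements holds. (F1) There exists $\xi\in\mathbb{R}$ such that $f(x)+\xi g(x)>0$ for all $x\in\mathbb{R}^n$. (F2) Both of the following hold: (a) there exists a unique $\xi\in\mathbb{R}$ such that $f(x)+\xi g(x)\ge 0$ for all $x\in\mathbb{R}^n$; also $f+\xi g$ attains its minimal value $0$; (b) on the minimum solution set $\mathcal V=\{f+\xi g=0\}=\{\nabla f+\xi\nabla g=0\}$ of $f+\xi g$, either $g>0$ everywhere on $\mathcal V$, or $g<0$ everywhere on $\mathcal V$. (F3) $\{g=0\}$ separates $\{f\le 0\}$.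
   Context: For a function $h:\mathbb{R}^n\to\mathbb{R}$ and $\star\in\{<,\le,=\}$, $\{h\star 0\}$ denotes $\{x\in\mathbb{R}^n\mid h(x)\star 0\}$; similarly $\{\nabla h=0\}=\{x\mid \nabla h(x)=0\}$. Quadratic functions may have zero quadratic part (affine functions are allowed). Separation: $\{g=0\}$ is said to separate $\{f\star 0\}$, $\star\in\{<,\le,=\}$, if there are non-empty subsets $L^-,L^+$ of $\{f\star 0\}$ with $L^-\cup L^+=\{f\star 0\}$ and $g(u)<0<g(v)$ for all $u\in L^-$, $v\in L^+$. *)

(* Defs.v *)
From mathcomp Require Import all_boot all_order all_algebra.
From mathcomp Require Import all_classical all_reals all_analysis.
Set Implicit Arguments.
Unset Strict Implicit.
Unset Printing Implicit Defensive.
Import Order.TTheory GRing.Theory Num.Theory numFieldNormedType.Exports.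
Local Open Scope classical_set_scope.
Local Open Scope ring_scope.

Definition quadratic (R : realType) (n : nat)
    (A : 'M[R]_n) (a : 'cV[R]_n) (a0 : R) (x : 'cV[R]_n) : R :=
  (x^T *m A *m x) 0 0 + 2 * (a^T *m x) 0 0 + a0.

Definition gradient (R : realType) (n : nat) (h : 'cV[R]_n -> R)
    (x : 'cV[R]_n) : 'cV[R]_n :=
  \col_i 'D_(delta_mx i 0) h x.

(* This is the relation "{g = 0} separates S"; it depends on the signs of g and
   not only on its zero set. Lm and Lp are subsets of S by the union equation. *)
Definition separates (R : realType) (n : nat) (g : 'cV[R]_n -> R)
    (S : set 'cV[R]_n) : Prop :=
  exists Lm Lp : set 'cV[R]_n,
    [/\ Lm !=set0, Lp !=set0, Lm `|` Lp = S &
        forall u v, Lm u -> Lp v -> g u < 0 < g v].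

Definition min_set (R : realType) (n : nat) (h : 'cV[R]_n -> R) :
    set 'cV[R]_n :=
  [set x | forall y, h x <= h y].

Definition F1 (R : realType) (n : nat) (f g : 'cV[R]_n -> R) : Prop :=
  exists xi : R, forall x, f x + xi * g x > 0.

Definition F2a (R : realType) (n : nat) (f g : 'cV[R]_n -> R) (xi : R) : Prop :=
  unique (fun z : R => forall x, f x + z * g x >= 0) xi /\
  exists x, f x + xi * g x = 0.

Definition F2b (R : realType) (n : nat) (f g : 'cV[R]_n -> R) (xi : R) : Prop :=
  let V := min_set (fun x => f x + xi * g x) in
  (forall x, V x -> g x > 0) \/ (forall x, V x -> g x < 0).

Definition F2 (R : realType) (n : nat) (f g : 'cV[R]_n -> R) : Prop :=
  exists xi : R, F2a f g xi /\ F2b f g xi.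

Definition F3 (R : realType) (n : nat) (f g : 'cV[R]_n -> R) : Prop :=
  separates g [set x | f x <= 0].

Definition exactly_one (P Q S : Prop) : Prop :=
  [\/ [/\ P, ~ Q & ~ S], [/\ ~ P, Q & ~ S] | [/\ ~ P, ~ Q & S]].

(* Main.v *)
(** The core is the S-lemma for two quadratic functions [f] and [g]: if [f >= 0]
    wherever [g >= 0] and [g] is positive somewhere, then [f + c g >= 0] for
    some [c].  With [-c] the infimum of [f / g] over [{g > 0}], this amounts to
    [f(u) / g(u) <= f(v) / g(v)] whenever [g(u) < 0 < g(v)].  That inequality only
    involves the line through [u] and [v]: on its homogenization, [g] vanishes
    at two points [v + r u] and [v + s u] with [r > 0 > s] and
    [r s = g(v) / g(u)], and combining [f >= 0] at these points with weights [-s]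
    and [r] eliminates the cross term of [f].

    If (F3) fails, [{f <= 0}] lies on one side of [g], so the S-lemma applies to
    [g] or [-g] and gives [f + c g >= 0].  If no such combination is positive
    everywhere, then each one vanishes somewhere.  Two of them cannot coexist,
    since at a zero of their average [f = g = 0]; and two zeros of the unique one
    with opposite signs of [g] would again produce a common zero of [f] and [g]
    on the segment joining them. *)
Require Import Defs.
From mathcomp Require Import all_boot all_order all_algebra.
From mathcomp Require Import ring lra.
From mathcomp Require Import all_classical all_reals all_analysis.
Set Implicit Arguments.
Unset Strict Implicit.
Unset Printing Implicit Defensive.
Import Order.TTheory GRing.Theory Num.Theory numFieldNormedType.Exports.
Local Open Scope classical_set_scope.
Local Open Scope ring_scope.

(** * Functions that are quadratic along every line *)

Definition quadratic_on_lines {R : realType} {V : lmodType R} (f : V -> R) : Prop :=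
  forall x d, exists L Q, forall t, f (x + t *: d) = f x + t * L + t ^+ 2 * Q.

Lemma quadratic_on_lines_comb {R : realType} {V : lmodType R} (f g : V -> R) (c : R) :
  quadratic_on_lines f -> quadratic_on_lines g ->
  quadratic_on_lines (fun x => f x + c * g x).
Proof.
move=> qf qg x d; have [Lf [Qf Ef]] := qf x d; have [Lg [Qg Eg]] := qg x d.
by exists (Lf + c * Lg), (Qf + c * Qg) => t; rewrite Ef Eg; ring.
Qed.

Lemma quadratic_on_linesN {R : realType} {V : lmodType R} (g : V -> R) :
  quadratic_on_lines g -> quadratic_on_lines (fun x => - g x).
Proof.
move=> qg x d; have [L [Q E]] := qg x d.
by exists (- L), (- Q) => t; rewrite E; ring.
Qed.

(* The point is [(v + t u) / (1 + t)], and [m] is the value at [(u, v)] of the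
   bilinear form polarizing the homogenization of [f]. *)
Lemma quadratic_on_lines_pencil {R : realType} {V : lmodType R} (f : V -> R) (u v : V) :
  quadratic_on_lines f -> exists m, forall t, 1 + t != 0 ->
    (1 + t) ^+ 2 * f (u + (1 + t)^-1 *: (v - u)) =
    f v + 2 * t * m + t ^+ 2 * f u.
Proof.
move=> qf; have [L [Q E]] := qf u (v - u).
have -> : f v = f u + L + Q.
  by rewrite -{1}(subrKC u v) -[v - u in LHS]scale1r E; ring.
by exists (f u + L / 2) => t t1; rewrite E; field.
Qed.

(** * Inequalities for real quadratic polynomials *)

(** Since [gu * gv < 0], the square root [w] of the reduced discriminant exceeds [|gm|], so the two
    roots have opposite signs. *)
Lemma indefinite_roots {R : realType} (gu gv gm : R) : gu < 0 -> 0 < gv ->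
  exists r s : R, [/\ 0 < r, s < 0, r * s * gu = gv &
    forall t, gv + 2 * t * gm + t ^+ 2 * gu = gu * (t - r) * (t - s)].
Proof.
move=> gu0 gv0.
have D0 : 0 < gm ^+ 2 - gu * gv.
  have := sqr_ge0 gm; have : gu * gv < 0 by rewrite nmulr_rlt0.
  lra.
set w := Num.sqrt (gm ^+ 2 - gu * gv).
have w2 : w ^+ 2 = gm ^+ 2 - gu * gv by rewrite sqr_sqrtr // ltW.
have /andP[wl wr] : - w < gm < w.
  rewrite -ltr_norml -(sqrtr_sqr gm) ltr_sqrt //.
  have : gu * gv < 0 by rewrite nmulr_rlt0.
  lra.
have gun0 : gu != 0 by rewrite lt_eqF.
have gvE : gv = (gm ^+ 2 - w ^+ 2) / gu by rewrite w2; field.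
exists ((- gm - w) / gu), ((- gm + w) / gu); split.
- by rewrite ltr_ndivlMr // mul0r; lra.
- by rewrite ltr_ndivrMr // mul0r; lra.
- by rewrite gvE; field.
- by move=> t; rewrite gvE; field.
Qed.

Lemma quadratic_ge0_at0 {R : realType} (p q r e : R) : 0 < e ->
  (forall t, 0 < t < e -> 0 <= p + t * q + t ^+ 2 * r) -> 0 <= p.
Proof.
move=> e0 H; rewrite leNgt; apply/negP => p0.
pose M := `|q| + `|r| + 1.
have M0 : 0 < M by rewrite /M; have := normr_ge0 q; have := normr_ge0 r; lra.
(* The bound [1] gives [t ^+ 2 <= t], and the last one then keeps the perturbation of [p] at most
   [- p / 2], so the value stays negative. *)
pose t := Num.min (e / 2) (Num.min 1 (- p / (2 * M))).
have t0 : 0 < t.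
  by rewrite !lt_min ltr01 !divr_gt0 ?oppr_gt0 ?mulr_gt0.
have te : t <= e / 2 by rewrite ge_min lexx.
have t1 : t <= 1 by rewrite !ge_min lexx orbT.
have tp : t * M <= - p / 2.
  have : t <= - p / (2 * M) by rewrite !ge_min lexx !orbT.
  rewrite ler_pdivlMr ?mulr_gt0 //; lra.
have /H : 0 < t < e by rewrite t0; lra.
have tq : t * q <= t * `|q| by rewrite ler_pM2l // ler_norm.
have tr : t ^+ 2 * r <= t * `|r|.
  apply: (@le_trans _ _ (t ^+ 2 * `|r|)).
    by rewrite ler_wpM2l ?sqr_ge0 ?ler_norm.
  by rewrite ler_wpM2r // expr2 ger_pMl.
move: tp; rewrite /M !mulrDr mulr1; lra.
Qed.

Lemma linear_term_eq0 {R : realType} (q r : R) :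
  (forall t, 0 <= t * q + t ^+ 2 * r) -> q = 0.
Proof.
move=> H; apply/eqP; rewrite eq_le -oppr_ge0; apply/andP; split.
- apply: (@quadratic_ge0_at0 R _ r 0 1) => // t /andP[t0 _].
  rewrite -(pmulr_rge0 _ t0); have := H (- t); rewrite sqrrN expr2; lra.
- apply: (@quadratic_ge0_at0 R _ r 0 1) => // t /andP[t0 _].
  rewrite -(pmulr_rge0 _ t0); have := H t; rewrite expr2; lra.
Qed.

(* The value [t = -1] corresponds to the point at infinity of the line. *)
Lemma pencil_cross_ge0 {R : realType} (fu fv fm gu gv gm : R) :
  gu < 0 -> 0 < gv ->
  (forall t, 1 + t != 0 -> 0 <= gv + 2 * t * gm + t ^+ 2 * gu ->
     0 <= fv + 2 * t * fm + t ^+ 2 * fu) ->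
  fv * gu <= fu * gv.
Proof.
move=> gu0 gv0 H; have [r [s [r0 s0 rs E]]] := indefinite_roots gm gu0 gv0.
have G0 t : s <= t <= r -> 0 <= gv + 2 * t * gm + t ^+ 2 * gu.
  move=> /andP[st tr]; rewrite E -mulrA mulr_le0 ?(ltW gu0) //.
  by rewrite mulr_le0_ge0 ?subr_le0 ?subr_ge0.
have Hr : 0 <= fv + 2 * r * fm + r ^+ 2 * fu.
  by apply: H; [apply: lt0r_neq0; lra | apply: G0; lra].
have Hs : 0 <= fv + 2 * s * fm + s ^+ 2 * fu.
  have [s1|s1] := eqVneq (1 + s) 0; last by apply: H => //; apply: G0; lra.
  (* For [s = -1] the hypothesis is applied at [s + t] with [0 < t < r], and the inequality passes
     to the limit [t -> 0]. *)
  apply: (@quadratic_ge0_at0 R _ (2 * fm + 2 * s * fu) fu r) => // t tr.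
  have := H (s + t); rewrite (_ : fv + 2 * (s + t) * fm + _ =
    fv + 2 * s * fm + s ^+ 2 * fu + t * (2 * fm + 2 * s * fu) + t ^+ 2 * fu);
    last by ring.
  apply; last by apply: G0; lra.
  by apply: lt0r_neq0; lra.
have K : 0 <= (r - s) * (fv - r * s * fu).
  have := addr_ge0 (mulr_ge0 (ltW r0) Hs) (mulr_ge0 (_ : 0 <= - s) Hr).
  rewrite (_ : r * _ + - s * _ = (r - s) * (fv - r * s * fu)); last by ring.
  by apply; lra.
move: K; rewrite pmulr_rge0 ?subr_gt0; last by lra.
by rewrite -(nmulr_rle0 _ gu0) -rs; lra.
Qed.

(** * The S-lemma and common zeros on a segment *)

Lemma S_lemma {R : realType} {V : lmodType R} (f g : V -> R) :
  quadratic_on_lines f -> quadratic_on_lines g ->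
  (exists x, 0 < g x) -> (forall x, 0 <= g x -> 0 <= f x) ->
  exists c, forall x, 0 <= f x + c * g x.
Proof.
move=> qf qg [z gz] H.
pose S := [set f x / g x | x in [set x | 0 < g x]].
have S0 : S !=set0 by exists (f z / g z); exists z.
have lbS : has_lbound S.
  by exists 0 => _ [x /= gx <-]; rewrite divr_ge0 ?H // ltW.
exists (- inf S) => x; rewrite mulNr subr_ge0.
case: (ltgtP (g x) 0) => gx.
(* For [g x < 0] the claim says that [f x / g x] is a lower bound of [S]; clearing denominators of
   opposite signs gives the cross inequality. *)
- rewrite -ler_ndivrMr //; apply: lb_le_inf => // _ [y /= gy <-].
  rewrite ler_pdivlMr // mulrAC ler_ndivrMr //.
  have [fm Ef] := quadratic_on_lines_pencil x y qf.
  have [gm Eg] := quadratic_on_lines_pencil x y qg.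
  apply: (@pencil_cross_ge0 R _ _ fm _ _ gm) => // t t1.
  rewrite -Ef // -Eg // !pmulr_rge0 ?exprn_even_gt0 //; exact: H.
- by rewrite -ler_pdivlMr //; apply: ge_inf => //; exists x.
- by rewrite gx mulr0 H // gx.
Qed.

(** With [h u = h v = 0] only the cross term of [h] survives on the line. As [h >= 0] for both signs
    of [t], that term is zero, so [h] also vanishes at the point of the positive root [r] of [g]. *)
Lemma zero_between {R : realType} {V : lmodType R} (h g : V -> R) (u v : V) :
  quadratic_on_lines h -> quadratic_on_lines g ->
  (forall x, 0 <= h x) -> h u = 0 -> h v = 0 -> g u < 0 -> 0 < g v ->
  exists w, h w = 0 /\ g w = 0.
Proof.
move=> qh qg h0 hu hv gu gv.
have [hm Eh] := quadratic_on_lines_pencil u v qh.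
have [gm Eg] := quadratic_on_lines_pencil u v qg.
have [r [s [r0 s0 rs E]]] := indefinite_roots gm gu gv.
have hm0 : hm = 0.
  have K t : 1 + t != 0 -> 0 <= t * hm.
    move=> t1; have := mulr_ge0 (sqr_ge0 (1 + t)) (h0 (u + (1 + t)^-1 *: (v - u))).
    rewrite Eh // hu hv; lra.
  have := K 1; have := K (- 2^-1).
  move=> /(_ ltac:(by apply: lt0r_neq0; lra)) K1 /(_ ltac:(by apply: lt0r_neq0; lra)) K2.
  lra.
have r1 : 1 + r != 0 by apply: lt0r_neq0; lra.
have r2 : (1 + r) ^+ 2 != 0 by rewrite expf_neq0.
exists (u + (1 + r)^-1 *: (v - u)); split; apply: (mulfI r2).
- by rewrite Eh // hu hv hm0; ring.
- by rewrite Eg // E; ring.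
Qed.

(** * Expansion, gradient and zero set of a matrix quadratic *)

Lemma quadratic_expansion {R : realType} {n : nat} (A : 'M[R]_n) (a : 'cV[R]_n)
    (a0 : R) (x d : 'cV[R]_n) (t : R) : A^T = A ->
  quadratic A a a0 (x + t *: d) = quadratic A a a0 x
    + t * (2 * (d^T *m (A *m x + a)) 0 0) + t ^+ 2 * (d^T *m A *m d) 0 0.
Proof.
move=> symA; rewrite /quadratic.
(* Transposing [1 x 1] products merges the two cross terms. *)
have sc (y : 'M[R]_1) : y^T = y by apply/matrixP => i j; rewrite mxE !ord1.
have E1 : (x + t *: d)^T *m A *m (x + t *: d) = x^T *m A *m x
    + t *: (d^T *m A *m x) + t *: (d^T *m A *m x) + t ^+ 2 *: (d^T *m A *m d).
  rewrite [_^T]linearD /= [(t *: d)^T]linearZ /= !(mulmxDl, mulmxDr) -!scalemxAl -!scalemxAr.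
  rewrite scalerA -expr2 -[x^T *m A *m d]sc !trmx_mul trmxK symA mulmxA.
  by rewrite !addrA.
rewrite E1 !mulmxDr -scalemxAr -[d^T *m a]sc trmx_mul trmxK mulmxA.
by rewrite !mxE; ring.
Qed.

Lemma quadratic_quadratic_on_lines {R : realType} {n : nat} (A : 'M[R]_n)
    (a : 'cV[R]_n) (a0 : R) : A^T = A -> quadratic_on_lines (quadratic A a a0).
Proof.
move=> symA x d.
exists (2 * (d^T *m (A *m x + a)) 0 0), ((d^T *m A *m d) 0 0) => t.
exact: quadratic_expansion.
Qed.

Lemma derive_on_line {R : realType} {n : nat} (f : 'cV[R]_n -> R)
    (x d : 'cV[R]_n) (L Q : R) :
  (forall t, f (x + t *: d) = f x + t * L + t ^+ 2 * Q) -> 'D_d f x = L.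
Proof.
move=> E; apply: cvg_lim => //.
have : L + t * Q @[t --> 0^'] --> L + 0 * Q.
  apply: cvg_within_filter; apply: cvgD; first exact: cvg_cst.
  by apply: cvgM; [exact: cvg_id | exact: cvg_cst].
rewrite mul0r addr0; apply: cvg_trans; apply: near_eq_cvg.
near=> t; have t0 : t != 0 by near: t; exact: nbhs_dnbhs_neq.
rewrite /= [t *: d + x]addrC E /GRing.scale /=.
by field.
Unshelve. all: by end_near. Qed.

Lemma gradient_quadratic {R : realType} {n : nat} (A : 'M[R]_n) (a : 'cV[R]_n)
    (a0 : R) (x : 'cV[R]_n) : A^T = A ->
  gradient (quadratic A a a0) x = 2 *: (A *m x + a).
Proof.
move=> symA; apply/matrixP => i j; rewrite ord1 !mxE.
rewrite (derive_on_line (fun t => quadratic_expansion a a0 x _ t symA)).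
by rewrite trmx_delta -rowE !mxE.
Qed.

Lemma min_set_ge0 {R : realType} {n : nat} (h : 'cV[R]_n -> R) (x0 : 'cV[R]_n) :
  (forall x, 0 <= h x) -> h x0 = 0 -> min_set h = [set x | h x = 0].
Proof.
move=> h0 hx0; apply/seteqP; split=> x /= hx; last by move=> y; rewrite hx.
by apply/eqP; rewrite eq_le h0 -hx0 hx.
Qed.

Lemma quadratic_zero_set_gradient {R : realType} {n : nat} (A : 'M[R]_n)
    (a : 'cV[R]_n) (a0 : R) (x0 : 'cV[R]_n) : A^T = A ->
  (forall x, 0 <= quadratic A a a0 x) -> quadratic A a a0 x0 = 0 ->
  [set x | quadratic A a a0 x = 0] = [set x | gradient (quadratic A a a0) x = 0].
Proof.
move=> symA; set h := quadratic A a a0 => h0 hx0.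
have gradE x : gradient h x = 2 *: (A *m x + a) by exact: gradient_quadratic.
have crit x : h x = 0 -> A *m x + a = 0.
  move=> hx; apply/matrixP => i j; rewrite ord1 [RHS]mxE.
  pose d : 'cV[R]_n := delta_mx i 0.
  have : 2 * (d^T *m (A *m x + a)) 0 0 = 0.
    apply: (@linear_term_eq0 R _ ((d^T *m A *m d) 0 0)) => t.
    by have := h0 (x + t *: d); rewrite /h quadratic_expansion // -/h hx add0r.
  by rewrite /d trmx_delta -rowE !mxE => /eqP; rewrite mulf_eq0 pnatr_eq0 /= => /eqP.
apply/seteqP; split=> x /=; rewrite gradE.
  by move=> /crit ->; rewrite scaler0.
move=> /eqP; rewrite scaler_eq0 pnatr_eq0 /= => /eqP cx.
(* Both [x] and [x0] are critical, so expanding from each towards the other gives [h x0 = h x + q]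
   and [h x = h x0 + q] with the same [q]; hence [h x = h x0]. *)
have E1 := quadratic_expansion a a0 x (x0 - x) 1 symA.
have E2 := quadratic_expansion a a0 x0 (x0 - x) (- 1) symA.
move: E1 E2; rewrite cx crit // mulmx0 mxE scaleN1r scale1r opprB !subrKC -/h hx0.
lra.
Qed.

(** * Separation and the three alternatives *)

Lemma separates_signs {R : realType} {n : nat} (g : 'cV[R]_n -> R) (S : set 'cV[R]_n) :
  separates g S -> [/\ exists2 u, S u & g u < 0, exists2 v, S v & 0 < g v &
    forall x, S x -> g x != 0].
Proof.
move=> [Lm [Lp [[u Lu] [v Lv] <- Lg]]]; have /andP[gu gv] := Lg _ _ Lu Lv; split.
- by exists u => //; left.
- by exists v => //; right.
- move=> x [Lx|Lx]; first by have /andP[/lt_eqF ->] := Lg _ _ Lx Lv.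
  by have /andP[_ /gt_eqF ->] := Lg _ _ Lu Lx.
Qed.

(** At points [u], [v] of [{f <= 0}] with [g u < 0 < g v], nonnegativity of [f + c g] forces [c = 0]
    and [f u = f v = 0]. This excludes (F1), and under (F2) it puts both points in the minimum
    set. *)
Lemma F_exclusive {R : realType} {n : nat} (f g : 'cV[R]_n -> R) :
  [/\ ~ (F1 f g /\ F2 f g), ~ (F1 f g /\ F3 f g) & ~ (F2 f g /\ F3 f g)].
Proof.
split.
- move=> [[c Hc] [xi [[[_ uniq] [x hx]] _]]].
  by have := Hc x; rewrite -(uniq c) ?hx ?ltxx // => y; exact: ltW.
- move=> [[c Hc] /separates_signs[[u /= fu gu] [v /= fv gv] _]].
  have := Hc u; have := Hc v; nra.
- move=> [[xi [[[h0 _] [x hx]] Vg]] /separates_signs[[u /= fu gu] [v /= fv gv] _]].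
  move: Vg; rewrite /F2b (min_set_ge0 h0 hx) => Vg.
  have xi0 : xi = 0 by have := h0 u; have := h0 v; nra.
  subst xi.
  have hu : f u + 0 * g u = 0 by have := h0 u; lra.
  have hv : f v + 0 * g v = 0 by have := h0 v; lra.
  case: Vg => Vg; first by have := Vg u hu; lra.
  by have := Vg v hv; lra.
Qed.

Lemma F_disjoint {R : realType} {n : nat} (f g : 'cV[R]_n -> R) :
  F1 f g \/ F2 f g \/ F3 f g -> forall x, g x = 0 -> 0 < f x.
Proof.
move=> H x gx; case: H => [[c /(_ x)]|H]; first by rewrite gx mulr0 addr0.
rewrite ltNge; apply/negP => fx; case: H.
- move=> [xi [[[h0 _] [y hy]]]]; rewrite /F2b (min_set_ge0 h0 hy) => Vg.
  have hx : f x + xi * g x = 0 by have := h0 x; rewrite gx mulr0; lra.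
  by case: Vg => /(_ x hx); rewrite gx ltxx.
- by move=> /separates_signs[_ _ /(_ x fx)]; rewrite gx eqxx.
Qed.

Lemma pencil_ge0_F1_or_F2 {R : realType} {n : nat} (f g : 'cV[R]_n -> R) (c : R) :
  quadratic_on_lines f -> quadratic_on_lines g ->
  (forall x, g x = 0 -> 0 < f x) -> (forall x, 0 <= f x + c * g x) ->
  F1 f g \/ F2 f g.
Proof.
move=> qf qg fg hc; have [|nF1] := EM (F1 f g); [by left | right].
have vanish d : (forall x, 0 <= f x + d * g x) -> exists x, f x + d * g x = 0.
  move=> hd; apply: contrapT => nx; apply: nF1; exists d => x.
  by rewrite lt_def hd andbT; apply/eqP => hx; apply: nx; exists x.
have [x0 hx0] := vanish c hc.
exists c; split; first (split; last by exists x0).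
- split=> // d hd; apply: contrapT => /eqP cd.
  have [x hx] : exists x, f x + (c + d) / 2 * g x = 0.
    by apply: vanish => x; have := hc x; have := hd x; lra.
  have h1 : f x + c * g x = 0 by have := hc x; have := hd x; lra.
  have h2 : f x + d * g x = 0 by have := hc x; have := hd x; lra.
  have gx : g x = 0.
    apply/eqP; have : (c - d) * g x = 0 by lra.
    by move/eqP; rewrite mulf_eq0 subr_eq0 (negPf cd).
  by have := fg x gx; rewrite gx in h1; lra.
- rewrite /F2b (min_set_ge0 hc hx0) /=.
  have gn0 x : f x + c * g x = 0 -> g x != 0.
    by move=> hx; apply/eqP => gx; have := fg x gx; rewrite gx in hx; lra.
  have nosep u v : f u + c * g u = 0 -> f v + c * g v = 0 -> g u < 0 -> 0 < g v -> False.
    move=> hu hv gu gv.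
    have qh := quadratic_on_lines_comb c qf qg.
    have [w [hw /eqP]] := zero_between qh qg hc hu hv gu gv.
    by rewrite (negPf (gn0 w hw)).
  have [gx0|gx0|/eqP] := ltgtP (g x0) 0; last by rewrite (negPf (gn0 x0 hx0)).
  + right=> x hx; rewrite lt_neqAle gn0 //= leNgt; apply/negP => gx.
    exact: nosep hx0 hx gx0 gx.
  + left=> x hx; rewrite lt_neqAle eq_sym gn0 //= leNgt; apply/negP => gx.
    exact: nosep hx hx0 gx gx0.
Qed.

(** As [g] has no zero on [{f <= 0}], this set splits by the sign of [g]; either both pieces are
    non-empty, or one sign does not occur. *)
Lemma F3_or_one_sided {R : realType} {n : nat} (f g : 'cV[R]_n -> R) :
  (forall x, g x = 0 -> 0 < f x) ->
  [\/ F3 f g, forall x, 0 <= g x -> 0 < f x | forall x, g x <= 0 -> 0 < f x].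
Proof.
move=> fg.
pose Lm := [set x | f x <= 0 /\ g x < 0]; pose Lp := [set x | f x <= 0 /\ 0 < g x].
have [Lp0|/set0P Lp0] := eqVneq Lp set0.
  constructor 2 => x; rewrite le_eqVlt => /orP[/eqP/esym/fg //|gx].
  by rewrite ltNge; apply/negP => fx; have : Lp x by []; rewrite Lp0.
have [Lm0|/set0P Lm0] := eqVneq Lm set0.
  constructor 3 => x; rewrite le_eqVlt => /orP[/eqP/fg //|gx].
  by rewrite ltNge; apply/negP => fx; have : Lm x by []; rewrite Lm0.
constructor 1; exists Lm, Lp; split=> //; last first.
  by move=> u v [_ gu] [_ gv]; rewrite gu gv.
apply/seteqP; split=> x /=; first by case=> -[].
move=> fx; have [gx|gx|gx] := ltgtP (g x) 0; [by left | by right |].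
by have := fg x gx; rewrite ltNge fx.
Qed.

Theorem theorem6 (R : realType) (n : nat)
    (A B : 'M[R]_n) (a b : 'cV[R]_n) (a0 b0 : R)
    (f g : 'cV[R]_n -> R)
    (symA : A^T = A) (symB : B^T = B)
    (fE : f = quadratic A a a0) (gE : g = quadratic B b b0)
    (g_neg : exists x, g x < 0) (g_pos : exists x, g x > 0) :
  [/\ (* the statements are mutually exclusive *)
      [/\ ~ (F1 f g /\ F2 f g), ~ (F1 f g /\ F3 f g) & ~ (F2 f g /\ F3 f g)],
      (* the two descriptions of the minimum solution set in (F2) *)
      forall xi : R, F2a f g xi ->
        min_set (fun x => f x + xi * g x) = [set x | f x + xi * g x = 0] /\
        [set x | f x + xi * g x = 0] =
          [set x | gradient f x + xi *: gradient g x = 0] &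
      [set x | f x <= 0] `&` [set x | g x = 0] = set0 <->
        exactly_one (F1 f g) (F2 f g) (F3 f g)].
Proof.
have qf : quadratic_on_lines f.
  by rewrite fE; exact: quadratic_quadratic_on_lines.
have qg : quadratic_on_lines g.
  by rewrite gE; exact: quadratic_quadratic_on_lines.
have [n12 n13 n23] := F_exclusive f g.
split=> //.
  move=> xi [[h0 _] [x0 hx0]]; split; first exact: min_set_ge0 h0 hx0.
  (* The combination is itself a matrix quadratic, so the zero set lemma applies to it. *)
  have hE x : f x + xi * g x = quadratic (A + xi *: B) (a + xi *: b) (a0 + xi * b0) x.
    rewrite fE gE /quadratic !linearD /= !linearZ /= !(mulmxDr, mulmxDl).
    by rewrite -!(scalemxAl, scalemxAr) !mxE; ring.
  have symC : (A + xi *: B)^T = A + xi *: B by rewrite linearD linearZ /= symA symB.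
  have gradE x : gradient f x + xi *: gradient g x =
      gradient (quadratic (A + xi *: B) (a + xi *: b) (a0 + xi * b0)) x.
    rewrite fE gE !gradient_quadratic // mulmxDl -scalemxAl.
    rewrite [in RHS]addrACA -[xi *: (B *m x) + _]scalerDr [RHS]scalerDr.
    by rewrite !scalerA [xi * 2]mulrC.
  under eq_set do rewrite hE; under [RHS]eq_set do rewrite gradE.
  by apply: (@quadratic_zero_set_gradient _ _ _ _ _ x0) => // [x|]; rewrite -hE.
have disjP : [set x | f x <= 0] `&` [set x | g x = 0] = set0 <->
    forall x, g x = 0 -> 0 < f x.
  split=> [E x gx|H]; last first.
    by apply/seteqP; split=> // x [/= fx /H]; rewrite ltNge fx.
  rewrite ltNge; apply/negP => fx.
  by have : ([set x | f x <= 0] `&` [set x | g x = 0]) x by []; rewrite E.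
rewrite disjP; split; last first.
  by move=> H; apply: F_disjoint; case: H => -[]; tauto.
move=> fg; suff : F1 f g \/ F2 f g \/ F3 f g.
  move=> [|[]] H; [constructor 1 | constructor 2 | constructor 3]; split; tauto.
suff : F3 f g \/ exists c, forall x, 0 <= f x + c * g x.
  by case=> [|[c /(pencil_ge0_F1_or_F2 qf qg fg)]]; tauto.
have [F|gf|gf] := F3_or_one_sided fg; [by left | right | right].
  by apply: S_lemma => // x /gf /ltW.
(* Here [f > 0] on [{g <= 0}]: the S-lemma is used with [- g], and the multiplier changes sign. *)
have [c Hc] : exists c, forall x, 0 <= f x + c * - g x.
  apply: S_lemma => //; first exact: quadratic_on_linesN.
    by have [x gx] := g_neg; exists x; rewrite oppr_gt0.
  by move=> x; rewrite oppr_ge0 => /gf /ltW.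
by exists (- c) => x; rewrite mulNr -mulrN.
Qed.
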